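(* Let $k,\Delta$ be positive integers and let $\varepsilon>0$. Every finite graph $G$ with maximum degree $\Delta$ and treewidth less than $k$ has a subdivision $\tilde G$ with growth $f_{\tilde G}(r)\leq (18k\Delta^2+\varepsilon)r+1$ for every positive integer $r$.
   Context: The growth of a finite graph $G$ is the function $f_G\colon\mathbb{N}\to\mathbb{N}$ where $f_G(r)$ is the maximum of $|V(H)|$ over all subgraphs $H$ of $G$ of radius at most $r$. Treewidth is the minimum, over tree-decompositions (bags indexed by the nodes of a tree, each edge contained in some bag, the bags containing any given vertex forming a non-empty subtree), of the maximum bag size minus $1$. A subdivision of $G$ is a graph obtained by replacing each edge $vw$ by a path with endpoints $v$ and $w$, internally disjoint from the rest of the graph. *)

(* Defs.v *)
From HB Require Import structures.
From mathcomp Require Import all_boot all_order all_algebra.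
From mathcomp Require Import boolp reals.
Set Implicit Arguments. Unset Strict Implicit. Unset Printing Implicit Defensive.
Import Order.TTheory GRing.Theory Num.Theory.

Definition simple_graph (V : finType) (e : rel V) : Prop :=
  symmetric e /\ irreflexive e.

Definition max_degree (V : finType) (e : rel V) : nat :=
  \max_(v : V) #|[set w | e v w]|.

Definition is_tree (I : finType) (t : rel I) : Prop :=
  [/\ simple_graph t, (0 < #|I|)%N,
      (forall i j, connect t i j) &
      (forall c : seq I, uniq c -> (2 < size c)%N -> ~~ cycle t c)].

Definition tree_decomposition (V : finType) (e : rel V)
    (I : finType) (t : rel I) (B : I -> {set V}) : Prop :=
  [/\ is_tree t,
      (forall v w, e v w -> exists i, (v \in B i) && (w \in B i)),
      (forall v, exists i, v \in B i) &
      (forall v i j, v \in B i -> v \in B j ->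
         connect [rel a b | [&& t a b, v \in B a & v \in B b]] i j)].

Definition td_width (V I : finType) (B : I -> {set V}) : nat :=
  (\max_(i : I) #|B i|).-1.

Definition treewidth_lt (V : finType) (e : rel V) (k : nat) : Prop :=
  exists (I : finType) (t : rel I) (B : I -> {set V}),
    tree_decomposition e t B /\ (td_width B < k)%N.

(* (W,h) is a subdivision of (V,e): each edge vw is replaced by a path
   phi v, P v w, phi w (P v w = the interior vertices), with interiors
   avoiding branch vertices and pairwise disjoint for distinct edges, and
   the graph consists exactly of these paths. *)
Definition subdivision_of (V : finType) (e : rel V) (W : finType) (h : rel W) : Prop :=
  exists (phi : V -> W) (P : V -> V -> seq W),
  injective phi /\
  [/\ (forall v w, e v w ->
         [&& path h (phi v) (rcons (P v w) (phi w)),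
             uniq (phi v :: rcons (P v w) (phi w)) &
             all (fun x => x \notin codom phi) (P v w)]),
      (forall v w, e v w -> P w v = rev (P v w)),
      (forall v w v' w', e v w -> e v' w' ->
         ~ ((v = v' /\ w = w') \/ (v = w' /\ w = v')) ->
         ~~ has (fun x => x \in P v' w') (P v w)),
      (forall x, x \in codom phi \/ exists v w, e v w /\ x \in P v w) &
      (forall x y, h x y -> exists v w,
         e v w /\ infix [:: x; y] (phi v :: rcons (P v w) (phi w)))].

(* (S,F) is a subgraph of (W,h) (F a set of edges, given as pairs, with both
   endpoints in S) of radius at most r: some centre c in S reaches every
   vertex of S by a walk of length <= r inside the subgraph. *)
Definition subgraph_radius_le (W : finType) (h : rel W)
    (S : {set W}) (F : {set W * W}) (r : nat) : Prop :=
  (forall x y, (x, y) \in F -> [&& h x y, x \in S & y \in S]) /\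
  exists2 c, c \in S & forall x, x \in S ->
    exists p : seq W,
      [/\ path [rel a b | ((a, b) \in F) || ((b, a) \in F)] c p,
          last c p = x & (size p <= r)%N].

Definition growth (W : finType) (h : rel W) (r : nat) : nat :=
  \max_(SF : {set W} * {set (W * W)} | `[< subgraph_radius_le h SF.1 SF.2 r >])
     #|SF.1|.

(* Main.v *)
Require Import Defs.
From HB Require Import structures.
From mathcomp Require Import all_boot all_order all_algebra.
From mathcomp Require Import boolp reals.
From mathcomp Require Import zify.
Import Order.TTheory GRing.Theory Num.Theory.
Set Implicit Arguments. Unset Strict Implicit. Unset Printing Implicit Defensive.

(* A bag of the tree-decomposition splits a vertex set with at most 2k*Delta
   outgoing edges into pieces that each receive at most half of these edges and
   at most k*Delta new ones; so V is cut recursively into nested clusters, each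
   with at most 2k*Delta outgoing edges, and splitting a cluster cuts at most
   2k*Delta further edges.  An edge that is cut at level i is subdivided q^i
   times, q being huge.  If q^i <= 2r < q^(i+1), a ball of radius 2r around an
   original vertex u stays in the level-i cluster of u; the edges of lower level
   have O(r) points altogether, and at most 4k*Delta half-edges of level at
   least i start in that cluster, each contributing at most 2r points.  A ball of
   radius r that contains an original vertex lies in such a ball, and any other
   one lies inside a single subdivided edge.  The total is at most
   (8k*Delta + 2)r + 1. *)

(** * Balanced separators *)

Section BalancedBag.
Variables (I : finType) (t : rel I).
Hypothesis tT : is_tree t.

Definition del_edge (i j a b : I) : bool :=
  t a b && ~~ ((a == i) && (b == j) || (a == j) && (b == i)).

Definition del_node (i a b : I) : bool := [&& t a b, a != i & b != i].

(** A simple path from [i] to [j] that avoids the edge [ij] has length at least two, so together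
    with that edge it closes a cycle of the tree. *)
Lemma tree_bridge i j : t i j -> ~~ connect (del_edge i j) i j.
Proof.
have [[tS tI] _ _ tA] := tT => tij; apply/negP => /connectP[p0 p0P jE].
move: jE; case/shortenP: p0P => p pP pU _ jE.
have pT : path t i p by apply: sub_path pP => a b /= /andP[].
have : ~~ cycle t (i :: p).
  apply: tA => //; case: p jE pP {pU pT} => [|x [|y p]] //= jE.
    by rewrite jE tI in tij.
  by rewrite -jE /del_edge !eqxx andbF.
by rewrite /= rcons_path pT -jE tS tij.
Qed.

Lemma del_node_edgel i j a b :
  connect (del_node i) a b -> connect (del_edge i j) a b.
Proof.
apply: connect_sub => x y /and3P[txy xi yi]; apply: connect1.
by rewrite /del_edge txy (negbTE xi) (negbTE yi) andbF.
Qed.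

Lemma del_node_edger i j a b :
  connect (del_node j) a b -> connect (del_edge i j) a b.
Proof.
apply: connect_sub => x y /and3P[txy xj yj]; apply: connect1.
by rewrite /del_edge txy (negbTE xj) (negbTE yj) andbF.
Qed.

Lemma del_node_sym i : connect_sym (del_node i).
Proof.
have [[tS _] _ _ _] := tT; apply: sym_connect_sym => a b.
by rewrite /del_node tS (andbC (a != i)).
Qed.

Variables (V : finType) (e : rel V) (B : I -> {set V}).
Hypothesis eTB : tree_decomposition e t B.

(** The vertices that the decomposition puts in the branch of [t - i] at [j]. One bag in the branch
    is enough: the bags of a vertex outside [B i] form a subtree that misses [i], so they all lie in
    the same branch. *)
Definition side (i j : I) : {set V} :=
  [set v | (v \notin B i) && [exists a, (v \in B a) && connect (del_node i) j a]].

Lemma bag_connect i v a b :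
  v \notin B i -> v \in B a -> v \in B b -> connect (del_node i) a b.
Proof.
have [_ _ _ conB] := eTB => vi va vb; apply: connect_sub (conB v a b va vb).
move=> x y /and3P[txy vx vy]; apply: connect1; rewrite /del_node txy /=.
by apply/andP; split; apply: contraNneq vi => <-.
Qed.

Lemma side_edge i j v w :
  e v w -> w \notin B i -> v \in side i j -> w \in side i j.
Proof.
have [_ edB _ _] := eTB => evw wi; rewrite !inE => /andP[vi].
case/existsP => a /andP[va ja]; have [b /andP[vb wb]] := edB _ _ evw.
rewrite wi; apply/existsP; exists b; rewrite wb.
exact: connect_trans ja (bag_connect vi va vb).
Qed.

Lemma side_exists i v : v \notin B i -> exists2 j, t i j & v \in side i j.
Proof.
have [_ _ covB _] := eTB; have [_ _ tC _] := tT => vi.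
have [a va] := covB v; have /connectP[p0 p0P aE] := tC i a.
move: aE; case/shortenP: p0P => p pP pU _ aE.
case: p aE pP pU => [|j p] /= aE; first by rewrite aE in va; rewrite va in vi.
case/andP=> tij jP /andP[ijp _]; exists j => //; rewrite inE vi.
apply/existsP; exists a; rewrite va; apply/connectP; exists p => //.
elim: p j jP ijp {tij aE} => //= x p IH j /andP[tjx xP].
rewrite !inE !negb_or !(eq_sym i) => /and3P[ji xi ip].
by rewrite /del_node tjx ji xi IH // inE negb_or eq_sym xi.
Qed.

(** A common vertex would give a walk from [i] to one of its bags, on through its bags, and then to
    [j], that never uses the edge [ij], against [tree_bridge]. *)
Lemma side_disjoint i j : t i j -> [disjoint side i j & side j i].
Proof.
move=> tij; rewrite disjoint_subset; apply/subsetP => v; rewrite !inE.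
case/andP=> vi /existsP[a /andP[va ja]]; apply/negP.
case/andP=> vj /existsP[b /andP[vb ib]]; case/negP: (tree_bridge tij).
apply: connect_trans (del_node_edger _ ib) _.
apply: (@connect_trans _ _ a); last by apply: del_node_edgel; rewrite del_node_sym.
by apply: del_node_edgel; apply: bag_connect vi _ _.
Qed.

(** This makes the descent in [balanced_bag] terminate: going from [i] to [j] and on to [l] loses at
    least the node [j]. *)
Lemma branch_proper i j l : t i j -> t j l -> l != i ->
  [set a | connect (del_node j) l a] \proper [set a | connect (del_node i) j a].
Proof.
have [[tS tI] _ _ _] := tT => tij tjl li.
have tji : t j i by rewrite tS.
have ij : i != j by apply: contraTneq tij => ->; rewrite tI.
have lj : l != j by apply: contraTneq tjl => ->; rewrite tI.
have nli : ~~ connect (del_node j) l i.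
  apply: contra (tree_bridge tji) => /(@del_node_edgel _ i).
  apply: connect_trans; apply: connect1.
  by rewrite /del_edge tjl eqxx (negbTE li) (negbTE lj) !andbF.
apply/properP; split; last first.
  exists j; rewrite !inE ?connect0 //; rewrite del_node_sym.
  apply/negP => /connectP[[|x p] /=]; first by move=> _ E; rewrite E eqxx in lj.
  by rewrite /del_node eqxx andbF.
apply/subsetP => a; rewrite !inE => /connectP[p pP ->].
have jl : connect (del_node i) j l by apply: connect1; rewrite /del_node tjl li eq_sym ij.
elim/last_ind: p pP => [|p x IH] //=; rewrite rcons_path last_rcons => /andP[pP].
move=> step; apply: connect_trans (IH pP) (connect1 _).
have lx : connect (del_node j) l x.
  by apply/connectP; exists (rcons p x); rewrite ?last_rcons // rcons_path pP.
have ly : connect (del_node j) l (last l p) by apply/connectP; exists p.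
case/and3P: step => txy _ _; rewrite /del_node txy /=.
by apply/andP; split; apply: contraNneq nli => <-.
Qed.

(** A pair is heavy if its side has more than half the weight. If the heavy pair [(i, j)] has the
    smallest branch, then no [(j, l)] is heavy: for [l != i] its branch would be smaller, and for
    [l = i] two disjoint sides would each exceed half. So the bag at [j] is balanced. *)
Lemma balanced_bag (w : V -> nat) : exists (i : I) (f : V -> I),
  (forall a b, e a b -> a \notin B i -> b \notin B i -> f a = f b) /\
  (forall l, 2 * \sum_(v | (v \notin B i) && (f v == l)) w v <= \sum_v w v).
Proof.
have [[tS tI] /card_gt0P[i0 _] _ _] := tT.
pose heavy (p : I * I) := t p.1 p.2 && (\sum_v w v < 2 * \sum_(v in side p.1 p.2) w v).
suff [i iP] : exists i, forall l, ~~ heavy (i, l).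
  (* [f] names the branch at [i] that contains the vertex; by [side_exists] the default [i] occurs
     only on the bag itself. *)
  exists i, (fun v => odflt i [pick l | t i l && (v \in side i l)]); split.
    move=> a b eab ai bi; congr odflt; apply: eq_pick => l /=; congr andb.
    apply/idP/idP; first exact: side_edge.
    rewrite !inE => /andP[_ /existsP[x /andP[bx lx]]]; rewrite ai.
    have [_ edB _ _] := eTB; have [y /andP[ay by_]] := edB _ _ eab.
    apply/existsP; exists y; rewrite ay.
    exact: connect_trans lx (bag_connect bi bx by_).
  move=> l; have := iP l; rewrite /heavy /= negb_and -leqNgt => /orP tl.
  have fP v : v \notin B i ->
      odflt i [pick l | t i l && (v \in side i l)] == l -> t i l && (v \in side i l).
    move=> vi; case: pickP => [m mP /= /eqP <- //|nP].
    by have [j tij vj] := side_exists vi; have := nP j; rewrite tij vj.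
  case: tl => [ntl|]; last first.
    apply: leq_trans; rewrite leq_pmul2l // big_mkcond [X in _ <= X]big_mkcond /=.
    apply: leq_sum => v _; case: ifP => // /andP[vi /(fP _ vi) /andP[_ vs]].
    by rewrite vs.
  rewrite big_pred0 ?muln0 // => v; apply/negP => /andP[vi /(fP _ vi)].
  by rewrite (negbTE ntl).
case: (pickP heavy) => [p0 p0P|none]; last by exists i0 => l; rewrite none.
case: (arg_minnP (fun p => #|[set a | connect (del_node p.1) p.2 a]|) p0P).
move=> [i j] /andP[/= tij hij] minij; exists j => l; apply/negP => hl.
have /andP[/= tjl wl] := hl; have [E|li] := eqVneq l i; last first.
  by have := minij _ hl; rewrite leqNgt proper_card ?branch_proper.
move: wl hij; rewrite {}E => wl wij {hl tjl minij}.
have: \sum_(v in side i j) w v + \sum_(v in side j i) w v <= \sum_v w v.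
  rewrite -bigU ?side_disjoint //= big_mkcond /=; apply: leq_sum => v _.
  by case: ifP.
lia.
Qed.

End BalancedBag.

(** * Nested clusters *)

Lemma card_pairs (V : finType) (P : pred V) (Q : rel V) :
  #|[set p : V * V | P p.1 && Q p.1 p.2]| = \sum_(a | P a) #|[set b | Q a b]|.
Proof.
under eq_bigr do rewrite cardsE -sum1_card.
by rewrite pair_big_dep cardsE -sum1_card; apply: eq_bigl => p; rewrite ?inE.
Qed.

Section Clusters.
Variables (V : finType) (e : rel V) (D : nat).
Hypotheses (eS : symmetric e) (eD : forall v, #|[set w | e v w]| <= D).

Definition boundary (U : {set V}) : {set V * V} :=
  [set p | [&& p.1 \in U, e p.1 p.2 & p.2 \notin U]].

Definition incident (X : {set V}) : {set V * V} :=
  [set p | (p.1 \in X) && e p.1 p.2].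

Definition cluster (L : eqType) (U : {set V}) (g : V -> L) (a : V) : {set V} :=
  [set b in U | g b == g a].

(** Pairs are ordered, so a cut edge counts twice, once from each end. *)
Definition crossing (L : eqType) (U : {set V}) (g : V -> L) : {set V * V} :=
  [set p | [&& p.1 \in U, e p.1 p.2, p.2 \in U & g p.1 != g p.2]].

Lemma card_incident X : #|incident X| <= #|X| * D.
Proof.
by rewrite card_pairs -sum_nat_const; apply: leq_sum => v _; apply: eD.
Qed.

Lemma boundary_incident U : boundary U \subset incident U.
Proof. by apply/subsetP => p; rewrite !inE => /and3P[-> ->]. Qed.

(** Pairs that end in [X] are charged, after reversal, to the half-edges at [X]. *)
Lemma sub_incident_swap (X : {set V}) (A A' : {set V * V}) :
  (forall a b, (a, b) \in A -> [|| (a, b) \in A' | e a b && (b \in X)]) ->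
  #|A| <= #|A'| + #|X| * D.
Proof.
move=> AP; pose sw (p : V * V) := (p.2, p.1).
have sA : A \subset A' :|: sw @: incident X.
  apply/subsetP => -[a b] /AP /orP[abA|/andP[eab bX]]; rewrite inE ?abA //.
  by apply/orP; right; apply/imsetP; exists (b, a); rewrite // inE /= bX eS.
apply: leq_trans (subset_leq_card sA) _; rewrite cardsU.
apply: leq_trans (leq_subr _ _) _; rewrite leq_add2l.
exact: leq_trans (leq_imset_card _ _) (card_incident X).
Qed.

Variable k : nat.
Hypotheses (k0 : 0 < k) (D0 : 0 < D).

(** Each vertex of [X] becomes its own cluster, and the rest of [U] is grouped by [f]. An edge
    between clusters has an end in [X], which bounds [crossing]; a group keeps at most [k * D] old
    boundary edges and gains at most [k * D] into [X]. The last hypothesis makes every group a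
    proper subset of [U]. *)
Lemma split_separator (U X : {set V}) (L : eqType) (f : V -> L) :
    #|X| <= k -> 1 < #|U| ->
    (forall a b, e a b -> a \notin X -> b \notin X -> f a = f b) ->
    (forall l, #|[set p in boundary U | (p.1 \notin X) && (f p.1 == l)]| <= k * D) ->
    (forall l, exists2 v, v \in U & (v \in X) || (f v != l)) ->
  exists g : V -> V + L,
    (forall a, a \in U ->
       #|cluster U g a| < #|U| /\ #|boundary (cluster U g a)| <= 2 * k * D) /\
    #|crossing U g| <= 2 * k * D.
Proof.
move=> Xk U1 fX fb fU; have XkD : #|X| * D <= k * D by rewrite leq_mul2r Xk orbT.
exists (fun v => if v \in X then inl v else inr (f v)); split; last first.
  have: #|crossing U (fun v => if v \in X then inl v else inr (f v))|
        <= #|incident X| + #|X| * D.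
    apply: sub_incident_swap => a b; rewrite !inE /= => /and4P[_ eab _].
    rewrite eab andbT; case: (boolP (a \in X)) => //= aX.
    case: (boolP (b \in X)) => //= bX.
    by rewrite (fX a b) ?eqxx.
  have := card_incident X; lia.
move=> a aU; case: (boolP (a \in X)) => aX.
  set C := cluster _ _ _.
  have C1 : C = [set a].
    apply/setP => b; rewrite !inE /= aX; case: ifP => bX.
      by apply/andP/eqP => [[_ /eqP[]]|->].
    by rewrite andbF; apply/esym; apply: contraFF bX => /eqP->.
  rewrite C1 cards1; split=> //.
  apply: leq_trans (subset_leq_card (boundary_incident _)) _.
  apply: leq_trans (card_incident _) _; rewrite cards1; nia.
set C := cluster _ _ _.
have CP b : (b \in C) = [&& b \in U, b \notin X & f b == f a].
  rewrite !inE (negbTE aX); congr andb; case: ifP => //= bX.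
clearbody C.
split.
  apply: proper_card; apply/properP; split.
    by apply/subsetP => b; rewrite CP => /andP[].
  have [v vU vP] := fU (f a); exists v => //.
  by rewrite CP vU; case: (v \in X) vP => //= /negbTE ->.
have: #|boundary C| <= #|[set p in boundary U | (p.1 \notin X) && (f p.1 == f a)]| + #|X| * D.
  apply: sub_incident_swap => b c; rewrite !inE /= !CP.
  move=> /and3P[/and3P[-> bX fba] ebc]; rewrite ebc bX fba /= andbT.
  case: (boolP (c \in U)) => //= cU; case: (boolP (c \in X)) => //= cX.
  by rewrite -(fX b c) // fba.
have := fb (f a); lia.
Qed.

Hypothesis tw : treewidth_lt e k.

Lemma split_cluster (U : {set V}) : 1 < #|U| -> #|boundary U| <= 2 * k * D ->
  exists (L : eqType) (g : V -> L),
    (forall a, a \in U ->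
       #|cluster U g a| < #|U| /\ #|boundary (cluster U g a)| <= 2 * k * D) /\
    #|crossing U g| <= 2 * k * D.
Proof.
(* A boundary of at most [k * D] edges needs no halving, and splitting off a single vertex makes
   progress. *)
move=> U1 bU; have [bk|bk] := leqP #|boundary U| (k * D).
  have [x xU] : exists x, x \in U by apply/card_gt0P; lia.
  have [||//|//||g gP] := @split_separator U [set x] unit (fun=> tt).
  - by rewrite cards1.
  - by [].
  - move=> l; apply: leq_trans bk; apply: subset_leq_card.
    by apply/subsetP => p; rewrite inE => /andP[].
  - by move=> l; exists x; rewrite // inE eqxx.
  by exists (V + unit)%type, g.
have [I [t [B [dB wB]]]] := tw; have [tT _ _ _] := dB.
(* With this weight the balanced bag halves the boundary. *)
pose w v := if v \in U then #|[set b | e v b && (b \notin U)]| else 0.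
have [i [f [fX fw]]] := balanced_bag tT dB w.
have sw (P : pred V) :
    \sum_(v | P v) w v = #|[set p in boundary U | P p.1]|.
  rewrite -big_mkcondr -card_pairs; apply: eq_card => p; rewrite !inE.
  by case: (p.1 \in U); rewrite ?andbF //= andbT andbC.
have swT : \sum_v w v = #|boundary U|.
  by rewrite sw; apply: eq_card => p; rewrite !inE andbT.
have Xk : #|B i| <= k.
  have : #|B i| <= \max_(i : I) #|B i| by apply: leq_bigmax.
  by move: wB; rewrite /td_width; lia.
have fw' l : #|[set p in boundary U | (p.1 \notin B i) && (f p.1 == l)]| <= k * D.
  have := fw l; rewrite swT (sw (fun v => (v \notin B i) && (f v == l))); nia.
have [|g gP] := split_separator Xk U1 fX fw'; last by exists (V + I)%type, g.
(* If [U] avoided the bag and carried the single label [l], the whole boundary would be counted by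
   [fw' l], against [bk]. *)
move=> l; apply/exists_inP; rewrite -[X in is_true X]negbK negb_exists_in.
apply/negP => /forall_inP nU; suff : #|boundary U| <= k * D by rewrite leqNgt bk.
apply: leq_trans (fw' l); apply: subset_leq_card; apply/subsetP => p pU.
rewrite inE pU /=.
have: p.1 \in U by move: pU; rewrite inE => /and3P[].
by move/nU; rewrite negb_or negbK.
Qed.

(* The sequence of nested partitions is recorded as an ultrametric [lev]: the
   clusters of level [i] are its closed balls of radius [i]. *)
Definition cluster_ultrametric (U : {set V}) (lev : V -> V -> nat) : Prop :=
  [/\ {in U &, forall a b, lev a b = lev b a},
      {in U & &, forall a b c, lev a c <= maxn (lev a b) (lev b c)},
      {in U &, forall a b, lev a b <= #|U|.-1},
      {in U &, forall a b, (lev a b == 0) = (a == b)} &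
      {in U, forall v i,
        #|[set p | [&& p.1 \in U, e p.1 p.2, lev v p.1 <= i
                     & (p.2 \notin U) || (i <= lev p.1 p.2)]]| <= 4 * k * D}].

(** Vertices separated by the first split get level [#|U|.-1], above all levels inside the pieces,
    which come from the induction. The bound [4 * k * D] adds boundary and crossing pairs,
    [2 * k * D] each. *)
Lemma ultrametric_cluster (U : {set V}) : #|boundary U| <= 2 * k * D ->
  exists lev, cluster_ultrametric U lev.
Proof.
have [n leUn] := ubnP #|U|; elim: n U leUn => // n IH U leUn bU.
have [U1|U1] := leqP #|U| 1.
  exists (fun _ _ => 0); split=> // [a b aU bU'|v vU i].
    by rewrite eqxx; apply/esym/eqP; apply: (card_le1_eqP U1).
  apply: leq_trans (_ : #|incident U| <= _).
    by apply/subset_leq_card/subsetP => p; rewrite !inE => /and3P[-> -> _].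
  apply: leq_trans (card_incident _) _; nia.
have [L [g [gC gX]]] := split_cluster U1 bU.
(* Indexing by the piece as a set gives all its vertices the same level function; other sets get a
   dummy. *)
have /choice[lv lvP] : forall C : {set V}, exists lev : V -> V -> nat,
    (exists2 a, a \in U & C = cluster U g a) -> cluster_ultrametric C lev.
  move=> C; case: (pselect (exists2 a, a \in U & C = cluster U g a)); last first.
    by move=> nC; exists (fun _ _ => 0).
  move=> [a aU ->]; have [sC bC] := gC a aU.
  by have [|//|lev levP] := IH (cluster U g a); [lia | exists lev].
have {}lvP a : a \in U -> cluster_ultrametric (cluster U g a) (lv (cluster U g a)).
  by move=> aU; apply: lvP; exists a.
have inC a b : b \in U -> g a = g b -> b \in cluster U g a.
  by move=> bU' gab; rewrite inE bU' gab /=.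
have eqC a b : g a = g b -> cluster U g a = cluster U g b.
  by move=> gab; apply/setP => c; rewrite !inE gab.
pose lev a b := if g a == g b then lv (cluster U g a) a b else #|U|.-1.
have levU : {in U &, forall a b, lev a b <= #|U|.-1}.
  move=> a b aU bU'; rewrite /lev; case: eqP => // gab.
  have [_ _ lvC _ _] := lvP a aU; have [sC _] := gC a aU.
  by have := lvC a b (inC _ _ aU erefl) (inC _ _ bU' gab); lia.
exists lev; split => //.
- move=> a b aU bU'; rewrite /lev eq_sym; case: eqP => // gba.
  rewrite (eqC b a) //; have [lvS _ _ _ _] := lvP a aU.
  by apply: lvS; apply: inC.
- move=> a b c aU bU' cU.
  have [gab|gab] := eqVneq (g a) (g b); last first.
    by rewrite leq_max [lev a b]/lev (negbTE gab) levU.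
  have [gbc|gbc] := eqVneq (g b) (g c); last first.
    by rewrite leq_max [lev b c]/lev (negbTE gbc) levU ?orbT.
  rewrite /lev gab gbc eqxx (eqC b a) //; have [_ lvU _ _ _] := lvP a aU.
  by apply: lvU; apply: inC; rewrite // gab.
- move=> a b aU bU'; rewrite /lev; case: (g a =P g b) => gab.
    by have [_ _ _ lv0 _] := lvP a aU; apply: lv0; apply: inC.
  have ->: (a == b) = false by apply: contra_notF gab => /eqP->.
  by apply/negbTE; lia.
(* Below the top level the ball around [v] lies in the piece of [v], and a pair from it that leaves
   [U] or crosses is a boundary pair of that piece. *)
move=> v vU i; have [iU|iU] := ltnP i #|U|.-1.
  have [_ _ _ _ lvN] := lvP v vU.
  apply: leq_trans (lvN v (inC _ _ vU erefl) i).
  apply/subset_leq_card/subsetP => p; rewrite !inE => /and4P[aU -> vi bi].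
  move: vi; rewrite /lev; case: eqP => [gv vi|_]; last lia.
  rewrite aU -gv eqxx vi /=; move: bi; rewrite /lev.
  case: (boolP (p.2 \in U)) => //= bU'; rewrite -gv (eq_sym (g p.2)).
  case: eqP => //= gvb; by rewrite -(eqC v) .
(* From the top level on, a pair inside [U] counts only if it crosses, as levels within a piece are
   smaller. *)
apply: leq_trans (_ : #|boundary U :|: crossing U g| <= _).
  apply/subset_leq_card/subsetP => p; rewrite !inE => /and4P[aU -> _].
  rewrite aU; case: (boolP (p.2 \in U)) => //= bU'; rewrite /lev; case: eqP => // gab.
  have [_ _ lvC _ _] := lvP _ aU; have [sC _] := gC _ aU.
  by have := lvC _ _ (inC _ _ aU erefl) (inC _ _ bU' gab); lia.
rewrite cardsU; lia.
Qed.
End Clusters.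

(** * Subdivisions and their balls *)

Section Subdivision.
Variables (V : finType) (e : rel V) (m : V -> V -> nat).
Hypotheses (eG : simple_graph e) (mS : forall u v, m u v = m v u).

Let eS : symmetric e. Proof. by have [] := eG. Qed.
Let eI : irreflexive e. Proof. by have [] := eG. Qed.

(* An interior point of an edge is stored with the edge oriented along
   [enum_rank], so that both orientations name the same point. *)
Definition raw_point (u v : V) (j : nat) : V + V * V * nat :=
  if j == 0 then inl u else if j == (m u v).+1 then inl v
  else if enum_rank u < enum_rank v then inr (u, v, j)
  else inr (v, u, (m u v).+1 - j).

Definition points : seq (V + V * V * nat) :=
  [seq inl v | v <- enum V] ++
  [seq raw_point p.1 p.2 j | p <- enum [set p : V * V | e p.1 p.2], j <- iota 0 (m p.1 p.2).+2].

Lemma branch_in v : inl v \in points.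
Proof. by rewrite mem_cat map_f ?mem_enum. Qed.

Definition branch (v : V) : seq_sub points := SeqSub (branch_in v).

(** The default [branch u] is reached only if [uv] is no edge or [j] is beyond its end; see
    [val_point]. *)
Definition point (u v : V) (j : nat) : seq_sub points := insubd (branch u) (raw_point u v j).

Definition adj (x y : seq_sub points) : bool :=
  `[< exists u v j, [/\ e u v, j <= m u v, x = point u v j & y = point u v j.+1] >].

Lemma adjP x y : reflect
  (exists u v j, [/\ e u v, j <= m u v, x = point u v j & y = point u v j.+1]) (adj x y).
Proof. exact: asboolP. Qed.

Lemma val_point u v j : e u v -> j <= (m u v).+1 -> val (point u v j) = raw_point u v j.
Proof.
move=> euv jm; rewrite /point insubdK //; change (raw_point u v j \in points).
rewrite mem_cat; apply/orP; right.
apply/allpairsPdep; exists (u, v), j; split => //.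
  by rewrite mem_enum inE.
by rewrite mem_iota.
Qed.

Lemma points_cases x : (exists v, x = branch v) \/
  (exists u v j, [/\ e u v, 0 < j <= m u v & x = point u v j]).
Proof.
have := valP x; rewrite /= mem_cat => /orP[/mapP[v _ xv]|].
  by left; exists v; apply: val_inj.
case/allpairsPdep => -[u v] [j] [].
rewrite mem_enum mem_iota inE [_.1]/= [_.2]/= => euv jm xE.
have [j0|jn0] := eqVneq j 0; first by left; exists u; apply: val_inj; rewrite /= xE j0.
have [j1|jn1] := eqVneq j (m u v).+1.
  by left; exists v; apply: val_inj; rewrite /= xE /raw_point j1 eqxx.
by right; exists u, v, j; split => //; [lia | apply: val_inj; rewrite /= xE val_point //; lia].
Qed.

Lemma point_first u v : e u v -> point u v 0 = branch u.
Proof. by move=> euv; apply: val_inj; rewrite val_point. Qed.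

Lemma point_last u v : e u v -> point u v (m u v).+1 = branch v.
Proof. by move=> euv; apply: val_inj; rewrite val_point // /raw_point eqxx. Qed.

Lemma edge_rank u v : e u v -> (enum_rank u < enum_rank v) = ~~ (enum_rank v < enum_rank u).
Proof.
move=> euv; have: (enum_rank u : nat) != enum_rank v; last by lia.
apply: contraTneq euv => /val_inj /enum_rank_inj ->; by rewrite eI.
Qed.

(** Both orientations of an edge name the same points, in opposite order; this is why [adj], defined
    along an orientation, is symmetric. *)
Lemma point_rev u v j : e u v -> j <= (m u v).+1 -> point v u j = point u v ((m u v).+1 - j).
Proof.
move=> euv jm; apply: val_inj; have evu : e v u by rewrite eS.
rewrite !val_point //; [| lia | by rewrite mS].
rewrite /raw_point (mS v u) (edge_rank euv).
have [->|j0] := eqVneq j 0; first by rewrite subn0 eqxx.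
have [->|j1] := eqVneq j (m u v).+1; first by rewrite subnn.
have -> : ((m u v).+1 - j == 0) = false by lia.
have -> : ((m u v).+1 - j == (m u v).+1) = false by lia.
by case: ifP => //= _; rewrite subKn.
Qed.

Lemma point_interior u v j : 0 < j <= m u v -> raw_point u v j =
  if enum_rank u < enum_rank v then inr (u, v, j) else inr (v, u, (m u v).+1 - j).
Proof.
move=> jm; rewrite /raw_point; have -> : (j == 0) = false by lia.
by have -> : (j == (m u v).+1) = false by lia.
Qed.

Lemma point_neq_branch u v j a : e u v -> 0 < j <= m u v -> point u v j <> branch a.
Proof.
move=> euv jm /(congr1 val); rewrite val_point ?point_interior //; last by lia.
by case: ifP.
Qed.

Lemma point_inj u v j u' v' j' : e u v -> e u' v' ->
  0 < j <= m u v -> 0 < j' <= m u' v' -> point u v j = point u' v' j' ->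
  [/\ u' = u, v' = v & j' = j] \/ [/\ u' = v, v' = u & j' = (m u v).+1 - j].
Proof.
move=> euv euv' jm jm' /(congr1 val); rewrite !val_point ?point_interior //; try lia.
case: ifP => _; case: ifP => _ [E1 E2 E3]; move: jm' E3; rewrite -E1 -E2 ?(mS v u);
  [left | right | right | left]; split=> //; lia.
Qed.

Lemma point_inj_pos u v j j' : e u v -> j <= (m u v).+1 -> j' <= (m u v).+1 ->
  point u v j = point u v j' -> j = j'.
Proof.
move=> euv jm jm' /(congr1 val); rewrite !val_point // /raw_point.
have uv : u <> v by move=> uv; rewrite uv eI in euv.
case: (enum_rank u < enum_rank v); do 4?case: eqP => ?; move=> E;
  by [lia | case: E | case: E => /uv | case: E => /esym/uv | case: E; lia].
Qed.

Lemma adj_sym : symmetric adj.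
Proof.
suff adjS x y : adj x y -> adj y x by move=> x y; apply/idP/idP; apply: adjS.
case/adjP=> u [v] [j] [euv jm -> ->]; apply/adjP; exists v, u, (m u v - j).
have evu : e v u by rewrite eS.
split=> //; first by rewrite (mS v u); lia.
  by rewrite (point_rev euv) //; [congr point; lia | lia].
by rewrite (point_rev euv) //; [congr point; lia | lia].
Qed.

Lemma adj_irr : irreflexive adj.
Proof.
move=> x; apply/negP => /adjP[u] [v] [j] [euv jm ->].
by move/(point_inj_pos euv); lia.
Qed.

(** * The subdivision property *)

Definition interior (u v : V) : seq (seq_sub points) := [seq point u v j | j <- iota 1 (m u v)].

Lemma rcons_interior u v : e u v ->
  rcons (interior u v) (branch v) = [seq point u v j | j <- iota 1 (m u v).+1].
Proof.
move=> euv; rewrite -(point_last euv) -map_rcons; congr map.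
by rewrite -(addn1 (m u v)) iotaD cats1 add1n addn1.
Qed.

Lemma path_points u v : e u v ->
  branch u :: rcons (interior u v) (branch v) = [seq point u v j | j <- iota 0 (m u v).+2].
Proof. by move=> euv; rewrite rcons_interior // -(point_first euv). Qed.

Lemma interiorP u v x : reflect (exists2 j, 0 < j <= m u v & x = point u v j) (x \in interior u v).
Proof.
apply: (iffP mapP) => -[j jm ->]; exists j => //; move: jm; rewrite mem_iota; lia.
Qed.

Lemma subdivision_adj : subdivision_of e adj.
Proof.
exists branch, interior; split; first by move=> u v [].
split.
- move=> u v euv; rewrite path_points //; apply/and3P; split.
  + rewrite rcons_interior // -(point_first euv).
    apply/(pathP (branch u)) => i; rewrite size_map size_iota => im.
    rewrite (nth_map 0) ?size_iota // nth_iota // -map_cons.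
    rewrite -[0 :: _]/(iota 0 (m u v).+2).
    rewrite (nth_map 0) ?size_iota ?nth_iota; try lia.
    by apply/adjP; exists u, v, i; split.
  + rewrite map_inj_in_uniq ?iota_uniq // => i j; rewrite !mem_iota => im jm.
    by apply: point_inj_pos => //; lia.
  + apply/allP => x /interiorP[j jm ->]; apply/codomP => -[a].
    exact: point_neq_branch.
- move=> u v euv; apply: (@eq_from_nth _ (branch u)).
    by rewrite size_rev !size_map !size_iota mS.
  move=> i; rewrite size_map size_iota => im; have := im; rewrite mS => im'.
  rewrite nth_rev !(size_map, size_iota) // !(nth_map 0) ?size_iota //; try lia.
  rewrite !nth_iota //; try lia.
  by rewrite point_rev //; [congr point; lia | lia].
- move=> u v u' v' euv euv' ne; apply/hasPn => x /interiorP[j jm ->].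
  apply/interiorP => -[j' jm']; move/(point_inj euv euv' jm jm') => H.
  by apply: ne; case: H => -[-> -> _]; [left | right].
- move=> x; case: (points_cases x) => [[v ->]|[u] [v] [j] [euv jm ->]].
    by left; apply: codom_f.
  by right; exists u, v; split=> //; apply/interiorP; exists j.
move=> x y /adjP[u] [v] [j] [euv jm -> ->]; exists u, v; split=> //.
rewrite path_points //; apply/infixP.
exists [seq point u v i | i <- iota 0 j], [seq point u v i | i <- iota j.+2 (m u v - j)].
rewrite -[[:: _; _]]/[seq point u v i | i <- iota j 2] -!map_cat; congr map.
have -> : (m u v).+2 = j + (2 + (m u v - j)) by lia.
by rewrite (iotaD 0 j) (iotaD (0 + j) 2) add0n addn2.
Qed.

(** * Walks along subdivided edges *)

Lemma adj_branch a y : adj (branch a) y -> exists2 b, e a b & y = point a b 1.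
Proof.
case/adjP=> u [v] [[|j]] [euv jm E ->]; last first.
  by case: (point_neq_branch euv _ (esym E)).
by move: E; rewrite point_first // => -[->]; exists v.
Qed.

Lemma adj_interior a b j y : e a b -> 0 < j <= m a b -> adj (point a b j) y ->
  y = point a b j.+1 \/ y = point a b j.-1.
Proof.
move=> eab jm /adjP[u] [v] [j'] [euv jm' E ->].
have j'0 : 0 < j'.
  case: j' {jm'} E => // E; case: (point_neq_branch eab jm (a := u)).
  by rewrite E point_first.
have [] := point_inj eab euv jm _ E; first by rewrite j'0.
  by move=> [-> -> ->]; left.
move=> [E1 E2 E3]; right; rewrite E1 E2 point_rev //; [congr point; lia | lia].
Qed.

Definition reach (n : nat) (x y : seq_sub points) : Prop :=
  exists p, [/\ path adj x p, last x p = y & size p <= n].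

Lemma reach_trans n n' x y z : reach n x y -> reach n' y z -> reach (n + n') x z.
Proof.
move=> [p [pP <- pn]] [p' [pP' <- pn']]; exists (p ++ p').
by rewrite cat_path pP pP' last_cat size_cat leq_add.
Qed.

Lemma reach_sym n x y : reach n x y -> reach n y x.
Proof.
move=> [p [pP <- pn]]; exists (rev (belast x p)); split.
- by rewrite rev_path; apply: sub_path pP => a b; rewrite adj_sym.
- by case: p {pP pn} => //= z p; rewrite rev_cons last_rcons.
- by rewrite size_rev size_belast.
Qed.

(** Each step changes the position by one, and the walk could leave the edge only through a branch
    vertex. *)
Lemma reach_edge n a b j x : e a b -> 0 < j <= m a b ->
    (forall c, ~ reach n (point a b j) (branch c)) -> reach n (point a b j) x ->
  exists i, [/\ 0 < i <= m a b, i <= j + n, j <= i + n & x = point a b i].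
Proof.
move=> eab jm nb [p [pP <- pn]].
suff [i [im ij ji xE]] : exists i, [/\ 0 < i <= m a b, i <= j + size p,
    j <= i + size p & last (point a b j) p = point a b i].
  by exists i; split=> //; lia.
elim/last_ind: p pP pn => [|p y IH].
  by exists j; split=> //; lia.
rewrite rcons_path size_rcons last_rcons => /andP[pP yP] pn.
have: size p <= n by lia.
move=> /(IH pP)[i [im ijn jin xE]].
have yi : y = point a b i.+1 \/ y = point a b i.-1.
  by apply: adj_interior => //; rewrite -xE.
have [i' [i'm ii' i'i yE]] : exists i', [/\ i' <= (m a b).+1, i' <= i.+1, i <= i'.+1 & y = point a b i'].
  by case: yi => ->; [exists i.+1 | exists i.-1]; split=> //; lia.
have yr : reach n (point a b j) y.
  by exists (rcons p y); rewrite rcons_path pP yP last_rcons size_rcons.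
exists i'; split=> //; try lia.
move: yr yE; have [->|i'0] := posnP i'.
  by rewrite point_first // => yr yE; case: (nb a); rewrite -yE.
have [->|i'nm] := eqVneq i' (m a b).+1.
  by rewrite point_last // => yr yE; case: (nb b); rewrite -yE.
by lia.
Qed.

(** Leaving [U] means traversing an edge with at least [n] interior points, which takes more than
    [n] steps. *)
Lemma reach_branch n (U : {set V}) u x : u \in U ->
    (forall a b, a \in U -> e a b -> m a b < n -> b \in U) ->
    reach n (branch u) x ->
  exists2 a, a \in U & x = branch a \/
    (exists b j, [/\ e a b, 0 < j <= m a b, j <= n & x = point a b j]).
Proof.
move=> uU Uclosed [p [pP <- pn]].
(* The invariant bounds the offset [j] by the number of steps made, so an edge followed to its far
   end has fewer than [n] interior points. *)
suff [a aU [xE|[b [j [eab jm jp xE]]]]] : exists2 a, a \in U &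
    last (branch u) p = branch a \/ (exists b j, [/\ e a b, 0 < j <= m a b,
      j <= size p & last (branch u) p = point a b j]).
- by exists a => //; left.
- by exists a => //; right; exists b, j; split=> //; lia.
elim/last_ind: p pP pn => [|p y IH]; first by exists u => //; left.
rewrite rcons_path size_rcons last_rcons => /andP[pP yP] pn.
have [|a aU [xE|[b [j [eab jm jp xE]]]]] := IH pP; first lia.
  rewrite xE in yP; have [b eab ->] := adj_branch yP.
  have [m0|m0] := posnP (m a b).
    by exists b; [apply: Uclosed aU eab _; lia | left; rewrite -(point_last eab) m0].
  by exists a => //; right; exists b, 1; split.
rewrite xE in yP; have [->|->] := adj_interior eab jm yP.
  have [jE|jm'] := eqVneq j (m a b).
    by exists b; [apply: Uclosed aU eab _; lia | left; rewrite -(point_last eab) jE].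
  by exists a => //; right; exists b, j.+1; split=> //; lia.
exists a => //; have [->|j1] := eqVneq j 1; first by left; rewrite -(point_first eab).
by right; exists b, j.-1; split=> //; lia.
Qed.

(** A walk inside a subgraph is a walk of [adj], so a subgraph of radius at most [r] lies in a ball
    of radius [r]. *)
Lemma growth_leq r N :
    (forall c (S : {set seq_sub points}), (forall x, x \in S -> reach r c x) -> #|S| <= N) ->
  growth adj r <= N.
Proof.
move=> bN; apply/bigmax_leqP => -[S F] /= /asboolP[FP [c _ cS]].
apply: (bN c) => x /cS[p [pP px pr]]; exists p; split=> //.
apply: sub_path pP => a b /= /orP[] /FP /and3P[] //.
by rewrite adj_sym.
Qed.

(** * Counting the points of a ball *)

Variables (lev : V -> V -> nat) (q N : nat).
Hypotheses (levU : forall a b c, lev a c <= maxn (lev a b) (lev b c))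
  (lev0 : forall a b, (lev a b == 0) = (a == b))
  (levN : forall v i,
     #|[set p | [&& e p.1 p.2, lev v p.1 <= i & i <= lev p.1 p.2]]| <= N)
  (qV : 2 * (#|V| * #|V|) < q) (q1 : 1 < q) (mE : forall a b, m a b = q ^ lev a b).

(** Three sets cover the ball: the branch vertices of [U], at most [r + 1]; the points on edges of
    level below [i], at most [r]; and the first [R] points on the half-edges in [H], at most
    [2 * N * r]. *)
Lemma branch_ball u r (S : {set seq_sub points}) : 0 < r ->
  (forall x, x \in S -> reach (2 * r) (branch u) x) -> #|S| <= (2 * N + 2) * r + 1.
Proof.
move=> r0 Su; have [R RE] : exists R, R = 2 * r by exists (2 * r).
rewrite -RE in Su; have R0 : 0 < R by lia.
(* An edge of level above [i] has more than [R] interior points, so it cannot be traversed. *)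
have [i /andP[qiR Rqi]] : exists i, q ^ i <= R < q ^ i.+1.
  by exists (trunc_log q R); apply: trunc_log_bounds.
pose U := [set a | lev u a <= i].
pose H := [set p | [&& e p.1 p.2, lev u p.1 <= i & i <= lev p.1 p.2]].
(* The largest possible number of interior points on an edge of level below [i]; for [i = 0] there
   is no such edge. *)
pose K := if i is i'.+1 then q ^ i' else 0.
pose ptx n (p : V * V * 'I_n) := point p.1.1 p.1.2 p.2.+1.
have u_refl : lev u u = 0 by apply/eqP; rewrite lev0.
(* For [i = 0] only [u] is in [U]; otherwise [2 * #|V| ^ 2 < q <= R = 2 * r]. *)
have UR : #|U| <= r + 1.
  case: (posnP i) => i0.
    apply: leq_trans (_ : #|[set u]| <= _); last by rewrite cards1; lia.
    by apply/subset_leq_card/subsetP => a; rewrite !inE i0 leqn0 lev0 eq_sym.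
  have : q <= q ^ i by rewrite -{1}(expn1 q) leq_exp2l.
  have UV : #|U| <= #|V| by apply: max_card.
  have : #|V| <= #|V| * #|V| by nia.
  by lia.
have sS : S \subset branch @: U :|: (ptx K @: setT :|: ptx R @: setX H setT).
  apply/subsetP => x /Su /(@reach_branch R U).
  case=> [|a b|a].
  - by rewrite inE u_refl.
  - rewrite !inE mE => ua _ mR; have : lev a b <= i.
      by rewrite -ltnS -(ltn_exp2l _ _ q1); lia.
    by have := levU u a b; lia.
  move=> aU [->|[b [j [eab jm jR ->]]]].
    by rewrite inE imset_f.
  have [li|li] := ltnP (lev a b) i.
    have jK : j.-1 < K.
      move: jm li; rewrite /K mE; clear -q1; case: i => // i' jm li.
      have : q ^ lev a b <= q ^ i' by rewrite leq_exp2l.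
      lia.
    rewrite inE; apply/orP; right; rewrite inE; apply/orP; left.
    apply/imsetP; exists ((a, b), Ordinal jK); rewrite ?inE // /ptx /=.
    by congr point; lia.
  have jR' : j.-1 < R by lia.
  rewrite inE; apply/orP; right; rewrite inE; apply/orP; right.
  apply/imsetP; exists ((a, b), Ordinal jR'); last by rewrite /ptx /=; congr point; lia.
  by move: aU; rewrite !inE /= eab li => ->.
(* For [i > 0], this follows from [q * K <= 2 * r] and [2 * #|V| ^ 2 < q]. *)
have KR : #|V| * #|V| * K <= r.
  rewrite /K; move: qiR; clear -qV RE; case: i => [|i'] qiR; first by rewrite muln0.
  by rewrite expnS in qiR; nia.
apply: leq_trans (subset_leq_card sS) _.
apply: leq_trans (leq_card_setU _ _) _.
have c1 := leq_trans (leq_imset_card branch U) UR.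
have [c2 _] := leq_card_setU (ptx K @: setT) (ptx R @: setX H setT).
have c3 := leq_imset_card (@ptx K) setT.
have c4 := leq_imset_card (@ptx R) (setX H setT).
rewrite cardsX cardsT card_ord in c4; rewrite cardsT !card_prod card_ord in c3.
have HN : #|H| * R <= N * R by rewrite leq_mul2r levN orbT.
have NR : N * R = 2 * (N * r) by rewrite RE mulnCA.
by apply: leq_trans (leq_add c1 (leq_trans c2 (leq_add c3 c4))) _; lia.
Qed.

Lemma growth_adj r : 0 < r -> growth adj r <= (2 * N + 2) * r + 1.
Proof.
move=> r0; apply: growth_leq => c S Sc.
have [[u cu]|nb] := pselect (exists u, reach r c (branch u)).
  apply: branch_ball r0 _ => x /Sc cx; rewrite mul2n -addnn.
  exact: reach_trans (reach_sym cu) cx.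
case: (points_cases c) => [[v cv]|[a [b [j [eab jm cE]]]]].
  by case: nb; exists v; exists [::].
(* [t] encodes the displacement [t - r] from [j]; position [i] comes from [t = i + r - j], where no
   subtraction is truncated. *)
pose f (t : 'I_(2 * r + 1)) := point a b (j + t - r).
have sS : S \subset f @: setT.
  apply/subsetP => x /Sc; rewrite cE => /(reach_edge eab jm).
  case=> [d|i [im ij ji ->]].
    by rewrite -cE => cd; case: nb; exists d.
  have tr : i + r - j < 2 * r + 1 by lia.
  by apply/imsetP; exists (Ordinal tr); rewrite // /f /=; congr point; lia.
apply: leq_trans (subset_leq_card sS) _.
apply: leq_trans (leq_imset_card _ _) _; rewrite cardsT card_ord; nia.
Qed.

End Subdivision.

(** * The growth bound *)

Local Open Scope ring_scope.

Theorem theorem17 (R : realType) (k Delta : nat) (eps : R) :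
  (0 < k)%N -> (0 < Delta)%N -> 0 < eps ->
  forall (V : finType) (e : rel V),
    simple_graph e -> max_degree e = Delta -> treewidth_lt e k ->
    exists (W : finType) (h : rel W),
      [/\ simple_graph h, subdivision_of e h &
          forall r : nat, (0 < r)%N ->
            ((growth h r)%:R : R)
              <= ((18 * k * Delta ^ 2)%N%:R + eps) * r%:R + 1].
Proof.
move=> k0 D0 eps0 V e eG eD tw; have [eS _] := eG.
have dD v : (#|[set w | e v w]| <= Delta)%N by rewrite -eD; apply: leq_bigmax.
(* The whole vertex set has no outgoing edges, so it can be the outermost cluster. *)
have bT : (#|boundary e [set: V]| <= 2 * k * Delta)%N.
  by rewrite (_ : boundary e _ = set0) ?cards0 //; apply/setP => p; rewrite !inE andbF.
have [lev [levS levU _ lev0 levN]] := ultrametric_cluster eS dD k0 D0 tw bT.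
(* The summand 2 keeps [q] above 1 even when [V] is empty. *)
pose q := (2 * (#|V| * #|V|) + 2)%N; pose m a b := (q ^ lev a b)%N.
have mS a b : m a b = m b a by rewrite /m levS ?inE.
exists (seq_sub (points e m)), (@adj V e m); split.
- by split; [apply: adj_sym | apply: adj_irr].
- exact: subdivision_adj.
move=> r r0.
have gr : (growth (@adj V e m) r <= (2 * (4 * k * Delta) + 2) * r + 1)%N.
  apply: (growth_adj eG mS (lev := lev) (q := q)) => //.
  - by move=> a b c; apply: levU; rewrite inE.
  - by move=> a b; apply: lev0; rewrite inE.
  - move=> v i; apply: leq_trans (levN v _ i); rewrite ?inE //.
    by apply/subset_leq_card/subsetP => p; rewrite !inE.
  - by rewrite /q; lia.
  - by rewrite /q; lia.
apply: (@le_trans _ _ ((18 * k * Delta ^ 2)%N%:R * r%:R + 1)); last first.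
  by rewrite lerD2r ler_wpM2r // lerDl ltW.
rewrite -natrM -[1]/(1%:R) -natrD ler_nat; apply: leq_trans gr _.
(* [8 * k * Delta + 2 <= 18 * k * Delta ^ 2], as [k] and [Delta] are positive. *)
by rewrite leq_add2r leq_mul2r; apply/orP; right; nia.
Qed.
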